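(* Let $q$ be a prime power, $n$ a positive integer, $\mu\ge 1$ an integer, and let $\mathbf v_1,\dots,\mathbf v_m\in\mathbb F_q^n$ be $m<n$ linearly independent vectors. Let these vectors be the rows of a matrix $\mathcal H\in\mathbb F_q^{m\times n}$, partitioned into mutually disjoint blocks of rows $H_0,H_0',H_1,H_1',\dots,H_\mu,H_\mu'$ such that $\operatorname{rk}H_i=\operatorname{rk}H_j$ for all $0\le i,j\le\mu$ and $\operatorname{rk}H_0'\ge\operatorname{rk}H_1'\ge\dots\ge\operatorname{rk}H_\mu'$. For $1\le i\le \mu$ let $\tilde H_i'$ be obtained from $H_i'$ by adding zero rows at the bottom so that it has $\operatorname{rk}H_0'$ rows. Define $$G_1(D)=\begin{bmatrix}H_0\\ H_0'\end{bmatrix}+\sum_{i=1}^{\mu}\begin{bmatrix}H_i\\ \tilde H_i'\end{bmatrix}D^i,\qquad G_2(D)=H_0'+\sum_{i=1}^{\mu}\tilde H_i'D^i ,$$ and let $V_1,V_2\subseteq\mathbb F_q[D]^n$ be the convolutional codes generated by $G_1(D)$ and $G_2(D)$, respectively. Let $(d_1)_f$ be the free distance of $V_1$, let $(d_2)_f^\perp$ be the free distance of the Euclidean dual $V_2^\perp$, and let $d^\perp$ be the minimum distance of $C^\perp$, where $C$ is the linear block code over $\mathbb F_q$ of length $n$ with parity check matrix $\mathcal H$ (so $C^\perp$ is the row space of $\mathcal H$). Then there exists an asymmetric quantum convolutional code with parameters $$[(n,\ \operatorname{rk}H_0,\ \mu^*;\ \gamma_1+\gamma_2,\ (d_z)_f/(d_x)_f)]_q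 ,$$ for some memory $\mu^*$, where $$\gamma_1=\mu(\operatorname{rk}H_\mu+\operatorname{rk}H_\mu')+\sum_{i=1}^{\mu-1}(\mu-i)\,[\operatorname{rk}H_{\mu-i}'-\operatorname{rk}H_{\mu-i+1}'],$$ $$\gamma_2=\mu\operatorname{rk}H_\mu'+\sum_{i=1}^{\mu-1}(\mu-i)\,[\operatorname{rk}H_{\mu-i}'-\operatorname{rk}H_{\mu-i+1}'],$$ and $(d_x)_f\ge (d_1)_f\ge d^\perp$ and $(d_z)_f\ge (d_2)_f^\perp$ (with the lower bounds $(d_1)_f$ and $(d_2)_f^\perp$ for $(d_x)_f$ and $(d_z)_f$ interchanged if $(d_1)_f>(d_2)_f^\perp$; the inequality $(d_1)_f\ge d^\perp$ holds in every case).
   Context: Convolutional codes. A matrix $G(D)\in\mathbb F_q[D]^{k\times n}$ is basic if it has a polynomial right inverse. Its overall constraint length is $\sum_{i=1}^k\gamma_i$, where $\gamma_i$ is the maximal degree of an entry in row $i$; a basic matrix is reduced if its overall constraint length is minimal among all basic matrices generating the same submodule of $\mathbb F_q[D]^n$. A convolutional code is the $\mathbb F_q[D]$-submodule generated by the rows of such a matrix. The weight of $\mathbf v(D)\in\mathbb F_q[D]^n$ is the total number of nonzero coefficients of its $n$ components. The free distance of a convolutional code is the minimum weight of its nonzero elements. The Euclidean dual is $V^\perp=\{\mathbf u(D)\in\mathbb F_q[D]^n:\ \mathbf u(D)\mathbf v(1/D)^t=0\ \text{for all }\mathbf v(D)\in V\}$. Asymmetric quantum convolutional code (AQCC), CSS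 type. It is specified by a basic (hence full-rank) stabilizer matrix $$S(D)=\begin{pmatrix}A(D)&|&0\\0&|&B(D)\end{pmatrix},\quad A\in\mathbb F_q[D]^{r\times n},\ B\in\mathbb F_q[D]^{s\times n},\quad A(D)B(1/D)^t=0$$ (symplectic orthogonality). Let $\mathcal A,\mathcal B\subseteq\mathbb F_q[D]^n$ be the row modules of $A$ and $B$; then $\mathcal A\subseteq\mathcal B^\perp$ and $\mathcal B\subseteq\mathcal A^\perp$. The code has parameters $[(n,K,\mu^*;\gamma,(d_z)_f/(d_x)_f)]_q$, where: $n$ is the frame size; $K=n-r-s$ is the number of logical qudits per frame; $\mu^*$ is the memory, i.e. the maximal degree of an entry of $S(D)$; $\gamma$ is the degree, i.e. the overall constraint length (sum over the rows of $S(D)$ of the maximal degree in the row), required to be minimal among all basic matrices with the same row module; and, with $\operatorname{wt}(T)$ denoting the minimum weight of an element of $T$, $(d_z)_f$ and $(d_x)_f$ are respectively the maximum and the minimum of the two numbers $\operatorname{wt}(\mathcal B^\perp\setminus\mathcal A)$ and $\operatorname{wt}(\mathcal A^\perp\setminus\mathcal B)$. Convention: whenever the value (bound) given for $(d_x)_f$ is larger than the one given for $(d_z)_f$, the two are interchanged. Writing $\mu^*$ means that no claim is made about the value of the memory. *)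

(* Defs.v *)
From HB Require Import structures.
From mathcomp Require Import all_boot all_order all_algebra.
From mathcomp Require Import boolp classical_sets constructive_ereal.

Set Implicit Arguments.
Unset Strict Implicit.
Unset Printing Implicit Defensive.

Import Order.TTheory GRing.Theory Num.Theory.
Local Open Scope classical_set_scope.
Local Open Scope ring_scope.

(* Minimum of a set of naturals, with min set0 = +oo: a free distance is +oo
   for the zero code, and so is the minimum weight of an empty set difference. *)
Definition nat_min (S : set nat) : \bar int :=
  if pselect (exists k, `[< S k >]) is left h then (Posz (ex_minn h))%:E
  else +oo%E.

Section BlockCodes.
Variables (F : fieldType) (n : nat).
Implicit Types (x y : 'rV[F]_n) (C : set 'rV[F]_n).

Definition hamming_dist x y : nat := #|[set j | x 0 j != y 0 j]%SET|.

Definition min_distance C : \bar int :=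
  nat_min [set hamming_dist z.1 z.2 | z in [set z | C z.1 /\ C z.2 /\ z.1 != z.2]].

Definition parity_check_code m (H : 'M[F]_(m, n)) : set 'rV[F]_n :=
  [set x | H *m x^T = 0].

Definition block_dual C : set 'rV[F]_n :=
  [set y | forall x, C x -> y *m x^T = 0].

End BlockCodes.

Section ConvolutionalCodes.
Variable F : fieldType.

Definition basic k n (G : 'M[{poly F}]_(k, n)) : Prop :=
  exists M : 'M[{poly F}]_(n, k), G *m M = 1%:M.

(* Since size p = deg p + 1 for p != 0, zero entries count as degree 0. *)
Definition constraint_length k n (G : 'M[{poly F}]_(k, n)) : nat :=
  (\sum_(i < k) \max_(j < n) (size (G i j)).-1)%N.

Definition memory k n (G : 'M[{poly F}]_(k, n)) : nat :=
  (\max_(i < k) \max_(j < n) (size (G i j)).-1)%N.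

Definition row_module k n (G : 'M[{poly F}]_(k, n)) : set 'rV[{poly F}]_n :=
  [set v | exists u : 'rV[{poly F}]_k, v = u *m G].

Definition reduced k n (G : 'M[{poly F}]_(k, n)) : Prop :=
  basic G /\
  forall k' (G' : 'M[{poly F}]_(k', n)), basic G' ->
    row_module G' = row_module G ->
    (constraint_length G <= constraint_length G')%N.

Definition weight n (v : 'rV[{poly F}]_n) : nat :=
  (\sum_(j < n) count (fun c => c != 0%R) (v 0%R j))%N.

Definition min_weight n (T : set 'rV[{poly F}]_n) : \bar int :=
  nat_min [set weight v | v in T].

Definition free_distance n (V : set 'rV[{poly F}]_n) : \bar int :=
  min_weight (V `\ 0).

(* p(1/D), as an element of the field F(D) of rational functions. *)
Definition at_invX (p : {poly F}) : {fraction {poly F}} :=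
  (map_poly (fun c : F => tofrac c%:P) p).[(tofrac 'X)^-1].

(* A(D) B(1/D)^t, computed over F(D). *)
Definition rev_prod r s n (A : 'M[{poly F}]_(r, n)) (B : 'M[{poly F}]_(s, n)) :
    'M[{fraction {poly F}}]_(r, s) :=
  map_mx (fun p : {poly F} => tofrac p) A *m (map_mx at_invX B)^T.

Definition euclidean_dual n (V : set 'rV[{poly F}]_n) : set 'rV[{poly F}]_n :=
  [set u | forall v, V v -> rev_prod u v = 0].

(* There is a CSS-type asymmetric quantum convolutional code with parameters
   [(n, K, mu; gamma, dz / dx)]. Full rank of S and orthogonality force
   r + s <= n, so the equation on K says K = n - r - s. *)
Definition is_aqcc (n K mu gamma : nat) (dz dx : \bar int) : Prop :=
  exists r s (A : 'M[{poly F}]_(r, n)) (B : 'M[{poly F}]_(s, n)),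
    let S := block_mx A 0 0 B in
    let wA := min_weight (euclidean_dual (row_module B) `\` row_module A) in
    let wB := min_weight (euclidean_dual (row_module A) `\` row_module B) in
    [/\ reduced S /\ rev_prod A B = 0,
        (r + s + K)%N = n,
        memory S = mu,
        constraint_length S = gamma
      & dz = Order.max wA wB /\ dx = Order.min wA wB].

End ConvolutionalCodes.

Section Construction.
Variables (F : fieldType) (m n mu : nat).
Implicit Types (H : 'M[F]_(m, n)) (B : 'I_mu.+1 -> {set 'I_m}).

(* The row indices are partitioned by the sets B 0, B' 0, ..., B mu, B' mu;
   blocks may be empty, which is why finset.partition is not used. *)
Definition row_partition B B' : Prop :=
  [/\ forall i j, i != j -> (B i :&: B j)%SET = finset.set0,
      forall i j, i != j -> (B' i :&: B' j)%SET = finset.set0,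
      forall i j, (B i :&: B' j)%SET = finset.set0
    & (\bigcup_i B i :|: \bigcup_i B' i)%SET = [set: 'I_m]%SET].

(* The submatrix of the rows of H with index in X, in increasing order. *)
Definition row_block H (X : {set 'I_m}) : 'M[F]_(#|X|, n) :=
  rowsub (fun i : 'I_#|X| => enum_val i) H.

(* M resized to k rows, adding zero rows at the bottom when p < k. *)
Definition pad_rows k p (M : 'M[F]_(p, n)) : 'M[F]_(k, n) :=
  \matrix_(i < k, j < n) oapp (fun i' : 'I_p => M i' j) 0 (insub (val i)).

(* Used when the rows of H are independent: a block then has as many rows as
   its rank. Resizing is then the identity on the
   blocks B' 0 and, when all B i have the same rank, on the B i, where it only
   makes the row counts agree syntactically. *)
Definition gen1 H B B' :
    'M[{poly F}]_(\rank (row_block H (B ord0)) + \rank (row_block H (B' ord0)), n) :=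
  \sum_(i < mu.+1) 'X^i *: map_mx polyC
     (col_mx (pad_rows _ (row_block H (B i))) (pad_rows _ (row_block H (B' i)))).

Definition gen2 H B' : 'M[{poly F}]_(\rank (row_block H (B' ord0)), n) :=
  \sum_(i < mu.+1) 'X^i *: map_mx polyC (pad_rows _ (row_block H (B' i))).

End Construction.

(* Main.v *)
(** Since the rows of [H] are independent, the rows of [G1] are
    [sum_i X^i h_(j,i)] for disjoint chains [h_(j,0), h_(j,1), ...] of rows of
    [H]. If the vectors [f_(j,i)] are dual to the [h_(j,i)], then the Euclidean
    dual of [V1] is generated by the vectors [f_(j,i-1) - X f_(j,i)], one for
    each non-bottom element of a chain, and by constant vectors orthogonal to
    [H]; its degree is thus read off as the number of non-bottom elements,
    which is [gamma1]. The code is the CSS code with [A = G2] and [B] this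
    generator of the dual of [V1]. Matrices whose leading row coefficients are
    independent have minimal overall constraint length by the predictable
    degree property. *)

Require Import Defs.
From HB Require Import structures.
From mathcomp Require Import all_boot all_order all_algebra.
From mathcomp Require Import perm zify.
From mathcomp Require Import boolp classical_sets constructive_ereal.

Set Implicit Arguments.
Unset Strict Implicit.
Unset Printing Implicit Defensive.

Import Order.TTheory GRing.Theory Num.Theory.
Local Open Scope ring_scope.

(** * Row-reduced matrices *)

Section RowReduced.
Variable F : fieldType.

Definition row_lead k n (e : 'I_k -> nat) (G : 'M[{poly F}]_(k, n)) : 'M[F]_(k, n) :=
  \matrix_(i, j) (G i j)`_(e i).

(** The [e i] are prescribed bounds, not computed degrees; independence of the coefficients at [e i]
    forces them to be exact. *)
Definition row_reduced k n (e : 'I_k -> nat) (G : 'M[{poly F}]_(k, n)) : Prop :=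
  (forall i j, (size (G i j) <= (e i).+1)%N) /\ row_free (row_lead e G).

Lemma coefM_top (p q : {poly F}) a b :
  (size p <= a.+1)%N -> (size q <= b.+1)%N -> (p * q)`_(a + b) = p`_a * q`_b.
Proof.
move=> sp sq; rewrite coefM.
have lt_a : (a < (a + b).+1)%N by rewrite ltnS leq_addr.
rewrite (bigD1 (Ordinal lt_a)) //= addKn big1 ?addr0 // => i; rewrite -val_eqE /=.
rewrite neq_ltn => /orP [lt_ia | lt_ai]; last first.
  by rewrite nth_default ?mul0r // (leq_trans sp).
rewrite [q`_ _]nth_default ?mulr0 //; apply: leq_trans sq _.
by rewrite -addnBAC ?(ltnW lt_ia) // -addn1 addnC leq_add2r subn_gt0.
Qed.

(** Let [deg u_i + e i] be maximal at [i0] among the nonzero [u_i]. At that degree, which is at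
    least [e j], the coefficient vector of [u G] is a nonzero vector times independent leading rows,
    so it cannot vanish. *)
Lemma predictable_degree k n (e : 'I_k -> nat) (G : 'M[{poly F}]_(k, n))
    (u : 'rV[{poly F}]_k) (j : 'I_k) :
  row_reduced e G -> u 0 j != 0 ->
  (e j <= \max_(l < n) (size ((u *m G) 0%R l)).-1)%N.
Proof.
move=> [szG freeG] uj0.
pose D i := ((size (u 0%R i)).-1 + e i)%N.
case: (@arg_maxnP _ j (fun i => u 0 i != 0) D uj0) => i0 ui0 geqD.
have Dmax i : u 0 i != 0 -> (D i <= D i0)%N := geqD i.
have coefd l : ((u *m G) 0 l)`_(D i0) =
    ((\row_i (if u 0 i == 0 then 0 else (u 0 i)`_(D i0 - e i))) *m row_lead e G) 0 l.
  rewrite !mxE coef_sum; apply: eq_bigr => i _; rewrite !mxE.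
  case: eqP => [-> | /eqP ui]; first by rewrite !mul0r coef0.
  have := Dmax i ui; move: (D i0) => d leD.
  rewrite -{1}(subnK (leq_trans (leq_addl _ _) leD)) coefM_top //.
  by move: leD; rewrite /D; move: (size _) (e i) => a b; lia.
have top_neq0 : (\row_i (if u 0 i == 0 then 0 else (u 0 i)`_(D i0 - e i))) != 0.
  apply: contra_neq ui0 => /rowP/(_ i0); rewrite !mxE /D addnK.
  by case: eqP => // _ /eqP; rewrite -[_`_ _]/(lead_coef _) lead_coef_eq0 => /eqP.
have [l nz_l] : exists l, ((u *m G) 0 l)`_(D i0) != 0.
  apply/existsP; apply: contraNT top_neq0 => /existsPn coef0.
  rewrite -(mulmx_free_eq0 _ freeG); apply/eqP/rowP => l.
  by rewrite -coefd [RHS]mxE; apply/eqP/negPn/coef0.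
apply: leq_trans (leq_bigmax l).
have : (D i0 < size ((u *m G) 0 l)%R)%N.
  by rewrite ltnNge; apply: contraNN nz_l => ?; rewrite nth_default.
by have := Dmax j uj0; rewrite {1}/D; lia.
Qed.

Lemma row_reduced_row_degree k n (e : 'I_k -> nat) (G : 'M[{poly F}]_(k, n)) i :
  row_reduced e G -> (\max_(j < n) (size (G i j)).-1)%N = e i.
Proof.
move=> redG; apply/eqP; rewrite eqn_leq; apply/andP; split.
  by apply/bigmax_leqP => j _; have := redG.1 i j; lia.
(* A unit vector [u] recovers row [i] itself and gives the lower bound. *)
have := predictable_degree (u := delta_mx 0 i) (j := i) redG.
rewrite -rowE mxE !eqxx oner_eq0 => /(_ isT).
by under eq_bigr do rewrite mxE.
Qed.

Lemma row_reduced_constraint_length k n (e : 'I_k -> nat) (G : 'M[{poly F}]_(k, n)) :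
  row_reduced e G -> constraint_length G = (\sum_i e i)%N.
Proof. by move=> redG; apply: eq_bigr => i _; apply: row_reduced_row_degree. Qed.

Lemma row_module_subset k n k' (G : 'M[{poly F}]_(k, n)) (G' : 'M[{poly F}]_(k', n)) :
  (row_module G `<=` row_module G')%classic -> exists T, G = T *m G'.
Proof.
move=> subGG'.
have ex_u i : exists u, row i G == u *m G'.
  have [u Du] : row_module G' (row i G) by apply: subGG'; exists (delta_mx 0 i); rewrite rowE.
  by exists u; apply/eqP.
exists (\matrix_i xchoose (ex_u i)); apply/row_matrixP => i.
by rewrite row_mul rowK; apply/eqP/(xchooseP (ex_u i)).
Qed.

(** Otherwise every term of the Leibniz expansion would contain a zero factor. *)
Lemma det_neq0_perm (R : comNzRingType) k (T : 'M[R]_k) :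
  \det T != 0 -> exists s : 'S_k, forall i, T i (s i) != 0.
Proof.
move=> nz_det; suff /existsP[s /forallP Ts] : [exists s : 'S_k, [forall i, T i (s i) != 0]].
  by exists s.
apply: contraNT nz_det => /existsPn zero_perm; apply/eqP/big1 => s _.
have /forallPn[i /negPn/eqP Ti0] := zero_perm s.
by rewrite (bigD1 i) //= Ti0 mul0r mulr0.
Qed.

Lemma basic_mulIr k l n (G : 'M[{poly F}]_(k, n)) (T U : 'M[{poly F}]_(l, k)) :
  basic G -> T *m G = U *m G -> T = U.
Proof.
move=> [M GM]; move/(congr1 (mulmx^~ M)).
by rewrite -!mulmxA GM !mulmx1.
Qed.

(* The transition matrix to another basic generator matrix has a nonzero
   determinant, hence a permutation [s] with nonzero entries at [(i, s i)];
   the [i]-th row of the other matrix then has degree at least [e (s i)]. *)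
Lemma row_reduced_reduced k n (e : 'I_k -> nat) (G : 'M[{poly F}]_(k, n)) :
  basic G -> row_reduced e G -> reduced G.
Proof.
move=> basG redG; split=> // k' G' basG' eqGG'.
have [T DG'] : exists T, G' = T *m G by apply: row_module_subset; rewrite eqGG'.
have [T' DG] : exists T, G = T *m G' by apply: row_module_subset; rewrite eqGG'.
have T'T : T' *m T = 1%:M by apply: (basic_mulIr basG); rewrite -mulmxA -DG' -DG mul1mx.
have TT' : T *m T' = 1%:M by apply: (basic_mulIr basG'); rewrite -mulmxA -DG -DG' mul1mx.
(* [T] and [T'] are mutually inverse, so they are square and [T] has a determinant. *)
have eqk : k = k'.
  by apply/eqP; rewrite eqn_leq (mulmx1_min T'T) (mulmx1_min TT').
subst k'.
have [s Ts] : exists s : 'S_k, forall i, T i (s i) != 0.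
  apply: det_neq0_perm; apply/eqP => detT0.
  by move/(congr1 determinant)/eqP: TT'; rewrite det_mulmx detT0 mul0r det1 eq_sym oner_eq0.
rewrite (row_reduced_constraint_length redG) (reindex_perm s) /=.
apply: leq_sum => i _.
have := predictable_degree (u := row i T) (j := s i) redG.
rewrite mxE => /(_ (Ts i)); rewrite -row_mul -DG'.
by under eq_bigr do rewrite mxE.
Qed.

End RowReduced.

(** * Basic and row-reduced matrices under block sums and constant factors *)

Section BlockGenerators.
Variable F : fieldType.

Lemma basic_block r1 r2 n1 n2 (A : 'M[{poly F}]_(r1, n1)) (B : 'M[{poly F}]_(r2, n2)) :
  basic A -> basic B -> basic (block_mx A 0 0 B).
Proof.
move=> [M AM] [N BN]; exists (block_mx M 0 0 N).
by rewrite mulmx_block !mul0mx !mulmx0 !addr0 !add0r AM BN -scalar_mx_block.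
Qed.

Lemma basic_dsub k1 k2 n (G : 'M[{poly F}]_(k1 + k2, n)) : basic G -> basic (dsubmx G).
Proof.
move=> [M GM]; exists (rsubmx M).
by rewrite mulmx_rsub mul_dsub_mx GM scalar_mx_block; apply: block_mxKdr.
Qed.

Lemma basic_mul_const k p n (G : 'M[{poly F}]_(k, p)) (E : 'M[F]_(p, n)) :
  basic G -> row_free E -> basic (G *m map_mx polyC E).
Proof.
move=> [M GM] /row_freeP[E' EE']; exists (map_mx polyC E' *m M).
by rewrite mulmxA -(mulmxA G) -map_mxM EE' map_mx1 mulmx1.
Qed.

Definition split_degree r1 r2 (e1 : 'I_r1 -> nat) (e2 : 'I_r2 -> nat) (i : 'I_(r1 + r2)) : nat :=
  match split i with inl i1 => e1 i1 | inr i2 => e2 i2 end.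

Lemma split_degreel r1 r2 (e1 : 'I_r1 -> nat) (e2 : 'I_r2 -> nat) i :
  split_degree e1 e2 (lshift r2 i) = e1 i.
Proof. by rewrite /split_degree (unsplitK (inl _ i)). Qed.

Lemma split_degreer r1 r2 (e1 : 'I_r1 -> nat) (e2 : 'I_r2 -> nat) i :
  split_degree e1 e2 (rshift r1 i) = e2 i.
Proof. by rewrite /split_degree (unsplitK (inr _ i)). Qed.

Lemma sum_split_degree r1 r2 (e1 : 'I_r1 -> nat) (e2 : 'I_r2 -> nat) :
  (\sum_i split_degree e1 e2 i = \sum_i e1 i + \sum_i e2 i)%N.
Proof.
rewrite big_split_ord; congr (_ + _)%N; apply: eq_bigr => i _.
  by rewrite split_degreel.
by rewrite split_degreer.
Qed.

Lemma row_reduced_block r1 r2 n1 n2 (e1 : 'I_r1 -> nat) (e2 : 'I_r2 -> nat)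
    (A : 'M[{poly F}]_(r1, n1)) (B : 'M[{poly F}]_(r2, n2)) :
  row_reduced e1 A -> row_reduced e2 B ->
  row_reduced (split_degree e1 e2) (block_mx A 0 0 B).
Proof.
move=> [szA /row_freeP[M AM]] [szB /row_freeP[N BN]]; split.
  move=> i j; rewrite -[i]splitK -[j]splitK.
  case: (split i) => i' /=; case: (split j) => j' /=;
    rewrite ?split_degreel ?split_degreer ?block_mxEul ?block_mxEur ?block_mxEdl ?block_mxEdr
      ?mxE ?size_poly0 ?szA ?szB //.
have -> : row_lead (split_degree e1 e2) (block_mx A 0 0 B) =
    block_mx (row_lead e1 A) 0 0 (row_lead e2 B).
  apply/matrixP => i j; rewrite mxE -[i]splitK -[j]splitK.
  case: (split i) => i' /=; case: (split j) => j' /=;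
    by rewrite ?split_degreel ?split_degreer ?block_mxEul ?block_mxEur ?block_mxEdl
      ?block_mxEdr ?mxE ?coef0.
apply/row_freeP; exists (block_mx M 0 0 N).
by rewrite mulmx_block !mul0mx !mulmx0 !addr0 !add0r AM BN -scalar_mx_block.
Qed.

Lemma row_reduced_dsub k1 k2 n (e : 'I_(k1 + k2) -> nat) (G : 'M[{poly F}]_(k1 + k2, n)) :
  row_reduced e G -> row_reduced (fun i => e (rshift k1 i)) (dsubmx G).
Proof.
move=> [szG /row_freeP[M GM]]; split=> [i j|]; first by rewrite mxE.
have -> : row_lead (fun i => e (rshift k1 i)) (dsubmx G) = dsubmx (row_lead e G).
  by apply/matrixP => i j; rewrite !mxE.
apply/row_freeP; exists (rsubmx M).
by rewrite mulmx_rsub mul_dsub_mx GM scalar_mx_block; apply: block_mxKdr.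
Qed.

(** A constant factor raises no degree and multiplies the leading coefficient matrix by [E], which
    preserves its rank. *)
Lemma row_reduced_mul_const k p n (e : 'I_k -> nat) (G : 'M[{poly F}]_(k, p))
    (E : 'M[F]_(p, n)) :
  row_reduced e G -> row_free E -> row_reduced e (G *m map_mx polyC E).
Proof.
move=> [szG freeG] freeE.
have coefGE i j t : ((G *m map_mx polyC E) i j)`_t = \sum_l (G i l)`_t * E l j.
  by rewrite mxE coef_sum; apply: eq_bigr => l _; rewrite mxE coefMC.
split=> [i j|].
  apply/leq_sizeP => t lt_t; rewrite coefGE big1 // => l _.
  by rewrite nth_default ?mul0r // (leq_trans (szG i l)).
have -> : row_lead e (G *m map_mx polyC E) = row_lead e G *m E.
  by apply/matrixP => i j; rewrite mxE coefGE mxE; apply: eq_bigr => l _; rewrite mxE.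
by rewrite /row_free mxrankMfree.
Qed.

Lemma row_reduced1 n : row_reduced (fun=> 0%N) (1%:M : 'M[{poly F}]_n).
Proof.
split=> [i j|]; first by rewrite mxE; case: (i == j); rewrite ?size_poly1 ?size_poly0.
suff -> : row_lead (fun=> 0%N) (1%:M : 'M[{poly F}]_n) = 1%:M.
  by apply/row_freeP; exists 1%:M; rewrite mulmx1.
by apply/matrixP => i j; rewrite !mxE coefMn coef1.
Qed.

End BlockGenerators.

(** * The substitution of 1/D and the Euclidean dual *)

Section EuclideanDuality.
Variable F : fieldType.
Local Notation frac := (fun p : {poly F} => tofrac p).

(** This commutation presents [at_invX] as the evaluation [horner_morph], hence as a ring
    morphism. *)
Fact at_invX_comm : commr_rmorph (@tofrac {poly F} \o @polyC F) (tofrac 'X)^-1.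
Proof. by move=> c; apply: mulrC. Qed.

Fact at_invX_zmod_morphism : zmod_morphism (@at_invX F).
Proof. by move=> p q; rewrite -[LHS]/(horner_morph at_invX_comm (p - q)) rmorphB. Qed.

Fact at_invX_monoid_morphism : monoid_morphism (@at_invX F).
Proof.
split=> [|p q]; first by rewrite -[LHS]/(horner_morph at_invX_comm 1) rmorph1.
by rewrite -[LHS]/(horner_morph at_invX_comm (p * q)) rmorphM.
Qed.

HB.instance Definition _ :=
  GRing.isZmodMorphism.Build {poly F} {fraction {poly F}} (@at_invX F) at_invX_zmod_morphism.
HB.instance Definition _ :=
  GRing.isMonoidMorphism.Build {poly F} {fraction {poly F}} (@at_invX F) at_invX_monoid_morphism.

Lemma at_invXC (c : F) : at_invX c%:P = tofrac c%:P.
Proof. exact: (horner_morphC at_invX_comm). Qed.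

Lemma at_invXX : at_invX ('X : {poly F}) = (tofrac 'X)^-1.
Proof. exact: (horner_morphX at_invX_comm). Qed.

Lemma rev_prodMl q r s n (C : 'M[{poly F}]_(q, r)) (A : 'M[{poly F}]_(r, n))
    (B : 'M[{poly F}]_(s, n)) :
  rev_prod (C *m A) B = map_mx frac C *m rev_prod A B.
Proof. by rewrite /rev_prod map_mxM mulmxA. Qed.

Lemma rev_prodMr q r s n (A : 'M[{poly F}]_(r, n)) (C : 'M[{poly F}]_(q, s))
    (B : 'M[{poly F}]_(s, n)) :
  rev_prod A (C *m B) = rev_prod A B *m (map_mx (@at_invX F) C)^T.
Proof. by rewrite /rev_prod map_mxM trmx_mul mulmxA. Qed.

Lemma rev_prod_const r s n (A : 'M[{poly F}]_(r, n)) (C : 'M[F]_(s, n)) :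
  rev_prod A (map_mx polyC C) = map_mx frac (A *m map_mx polyC C^T).
Proof.
rewrite /rev_prod map_mxM; congr (_ *m _).
by apply/matrixP => i j; rewrite !mxE at_invXC.
Qed.

(** A codeword [w B] only adds a right factor depending on [w], so testing the rows of [B]
    suffices. *)
Lemma euclidean_dual_row_module s n (B : 'M[{poly F}]_(s, n)) u :
  euclidean_dual (row_module B) u <-> rev_prod u B = 0.
Proof.
split=> [dual_u | uB0 v [w ->]]; last by rewrite rev_prodMr uB0 mul0mx.
apply/matrixP => i j; have := dual_u (delta_mx 0 j *m B).
case/(_ (ex_intro _ _ erefl))/matrixP/(_ i 0).
by rewrite rev_prodMr map_delta_mx trmx_delta -colE !mxE.
Qed.

End EuclideanDuality.

(** * Generators supported on chains *)

Section Chains.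
Variables (F : fieldType) (m n k : nat).
(* Row [p] of [H] sits at level [lv p] of the chain [ch p], and [e j] is the
   top level of chain [j]. *)
Variables (ch lv : 'I_m -> nat) (e : nat -> nat).
Hypothesis ch_lt : forall p, (ch p < k)%N.
Hypothesis lv_le : forall p, (lv p <= e (ch p))%N.
Hypothesis ch_lv_inj : forall p q, ch p = ch q -> lv p = lv q -> p = q.
Hypothesis ch_lv_onto : forall j i, (j < k)%N -> (i <= e j)%N -> exists p, ch p = j /\ lv p = i.

Definition chain_step : pred 'I_m := fun p => (0 < lv p)%N.

(** The generator in coordinates with respect to the rows of [H]. *)
Definition chain_mx : 'M[{poly F}]_(k, m) :=
  \matrix_(j, p) (if ch p == j then 'X^(lv p) else 0).

(* Equal to [p] itself when [lv p = 0], since the predecessor is truncated. *)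
Definition chain_pred (p : 'I_m) : 'I_m :=
  odflt p [pick q | (ch q == ch p) && (lv q == (lv p).-1)].

(** The vectors [f_(pred p) - X f_p], in coordinates with respect to the dual vectors [f]. *)
Definition step_mx : 'M[{poly F}]_(#|chain_step|, m) :=
  \matrix_(x, p) ((p == chain_pred (enum_val x))%:R - (p == enum_val x)%:R * 'X).

Lemma ch_chain_pred p : ch (chain_pred p) = ch p.
Proof. by rewrite /chain_pred; case: pickP => //= q /andP[/eqP]. Qed.

Lemma lv_chain_pred p : lv (chain_pred p) = (lv p).-1.
Proof.
rewrite /chain_pred; case: pickP => [q /andP[_ /eqP] | /=] //.
have [|q [chq lvq]] := ch_lv_onto (i := (lv p).-1) (ch_lt p).
  exact: leq_trans (leq_pred _) (lv_le p).
by move/(_ q); rewrite chq lvq !eqxx.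
Qed.

(** A chain has exactly one element at each level from 0 to [e j]. *)
Lemma sum_chain (f : nat -> nat) (j : 'I_k) :
  (\sum_(p | ch p == j) f (lv p) = \sum_(i < (e j).+1) f i)%N.
Proof.
rewrite (partition_big (fun p => inord (lv p) : 'I_(e j).+1) xpredT) //=.
apply: eq_bigr => i _.
have [q [chq lvq]] := ch_lv_onto (i := i) (ltn_ord j) (ltn_ord i).
rewrite (big_pred1 q) ?lvq // => p.
apply/andP/eqP => [[/eqP chp /eqP/(congr1 val)] | ->].
  rewrite /= inordK => [lvp|]; last by rewrite ltnS -chp.
  by apply: ch_lv_inj; rewrite ?chp ?chq ?lvp ?lvq.
by rewrite chq lvq inord_val !eqxx.
Qed.

Lemma sum_chains (f : nat -> nat) :
  (\sum_p f (lv p) = \sum_(j < k) \sum_(i < (e j).+1) f i)%N.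
Proof.
rewrite (partition_big (fun p => Ordinal (ch_lt p)) xpredT) //=.
by apply: eq_bigr => j _; rewrite -sum_chain; apply: eq_bigl => p; rewrite -val_eqE.
Qed.

(** Chain [j] has [e j] elements above its bottom. *)
Lemma card_chain_steps : #|chain_step| = (\sum_(j < k) e j)%N.
Proof.
rewrite -sum1_card big_mkcond /=.
transitivity (\sum_p (0 < lv p : nat))%N.
  by apply: eq_bigr => p _; rewrite -[p \in _]/(0 < lv p)%N; case: (0 < lv p)%N.
rewrite (sum_chains (fun i => (0 < i)%N : nat)); apply: eq_bigr => j _.
by rewrite big_ord_recl add0n (eq_bigr (fun=> 1%N)) // sum1_card card_ord.
Qed.

Lemma row_count_chains : (m = k + \sum_(j < k) e j)%N.
Proof.
rewrite -[LHS]card_ord -sum1_card (sum_chains (fun=> 1%N)).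
under eq_bigr do rewrite sum1_card card_ord -add1n.
by rewrite big_split /= sum1_card card_ord.
Qed.

(** The right inverse selects the bottom of each chain, where the entry is [X^0 = 1]. *)
Lemma basic_chain_mx : basic chain_mx.
Proof.
exists (\matrix_(p, j) ((ch p == j) && (lv p == 0%N))%:R).
apply/matrixP => j j'; rewrite !mxE.
have [q [chq lvq]] := ch_lv_onto (ltn_ord j) (leq0n _).
rewrite (bigD1 q) //= !mxE chq lvq !eqxx andbT expr0 mul1r -val_eqE /=.
rewrite big1 ?addr0 // => p; rewrite !mxE; case: (ch p =P j) => [chp|]; last by rewrite mul0r.
case: (lv p =P 0%N) => [lvp|]; last by rewrite andbF mulr0.
by case/eqP; apply: ch_lv_inj; rewrite ?chp ?chq ?lvp ?lvq.
Qed.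

(** The leading coefficients mark the tops of the chains, one per row and in distinct columns. *)
Lemma row_reduced_chain_mx : row_reduced (fun j : 'I_k => e j) chain_mx.
Proof.
split=> [j p|].
  rewrite mxE; case: eqP => [<-|]; last by rewrite size_poly0.
  by rewrite size_polyXn ltnS.
apply/row_freeP; exists (\matrix_(p, j) ((ch p == j) && (lv p == e j))%:R).
apply/matrixP => j j'; rewrite !mxE.
have [q [chq lvq]] := ch_lv_onto (ltn_ord j) (leqnn _).
rewrite (bigD1 q) //= !mxE chq lvq !eqxx coefXn eqxx mul1r -val_eqE /=.
rewrite big1 ?addr0; first by case: eqP => // ->; rewrite eqxx.
move=> p; rewrite !mxE; case: (ch p =P j) => [chp|]; last by rewrite coef0 mul0r.
rewrite coefXn; case: (e j =P lv p) => [lvp|]; last by rewrite mul0r.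
by case/eqP; apply: ch_lv_inj; rewrite ?chp ?chq ?lvq ?lvp.
Qed.

Lemma step_mx_mul q (M : 'M[{poly F}]_(m, q)) x y :
  (step_mx *m M) x y = M (chain_pred (enum_val x)) y - 'X * M (enum_val x) y.
Proof.
rewrite mxE; under eq_bigr do rewrite mxE mulrBl -mulrA.
rewrite big_split /= sumrN; congr (_ - _).
  by rewrite (bigD1 (chain_pred (enum_val x))) //= eqxx mul1r big1 ?addr0 // =>
    p /negPf->; rewrite mul0r.
by rewrite (bigD1 (enum_val x)) //= eqxx mul1r big1 ?addr0 // => p /negPf->; rewrite mul0r.
Qed.

Lemma enum_val_lv_gt0 (x : 'I_#|chain_step|) : (0 < lv (enum_val x))%N.
Proof. exact: (enum_valP x). Qed.

(* Column [x] of the right inverse solves [y (pred p) - X y p = [p = x]] by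
   walking down the chain from [x], starting with [y (pred x) = 1]. *)
Lemma basic_step_mx : basic step_mx.
Proof.
exists (\matrix_(p, x) (if (ch p == ch (enum_val x)) && (lv p < lv (enum_val x))%N
  then 'X^(lv (enum_val x) - (lv p).+1) else 0)).
apply/matrixP => x y; rewrite step_mx_mul !mxE ch_chain_pred lv_chain_pred.
have := enum_val_lv_gt0 x; have -> : (x == y) = (enum_val x == enum_val y).
  by rewrite (inj_eq enum_val_inj).
move: (enum_val x) (enum_val y) => p q p0.
have [chpq|ne_ch] := eqVneq (ch p) (ch q); last first.
  by rewrite mulr0 subrr; case: eqP => // pq; rewrite pq eqxx in ne_ch.
rewrite /= prednK //; have [lt_pq|lt_qp|eq_pq] := ltngtP (lv p) (lv q).
- rewrite -exprS -subSn // subSS subrr.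
  by case: eqP => // pq; rewrite pq ltnn in lt_pq.
- rewrite mulr0 subr0.
  by case: eqP => // pq; rewrite pq ltnn in lt_qp.
- by rewrite (ch_lv_inj chpq eq_pq) eqxx mulr0 subr0 subnn expr0.
Qed.

(** The coefficient of [X] in the row of [p] is [- f_p], and distinct rows have distinct [p]. *)
Lemma row_reduced_step_mx : row_reduced (fun=> 1%N) step_mx.
Proof.
split=> [x p|].
  rewrite mxE; apply/leq_sizeP => -[|[|t]] // _.
  by rewrite coefB -!polyC_natr mulrC coefMC coefC coefX mul0r subr0.
have neq_pred (x : 'I_#|chain_step|) : (enum_val x == chain_pred (enum_val x)) = false.
  by apply/eqP => /(congr1 lv); rewrite lv_chain_pred; have := enum_val_lv_gt0 x; lia.
apply/row_freeP; exists (\matrix_(p, x) - (p == enum_val x)%:R).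
apply/matrixP => x y; rewrite !mxE.
have lead1 p : (row_lead (fun=> 1%N) step_mx) x p = - (p == enum_val x)%:R.
  by rewrite !mxE coefB -!polyC_natr mulrC coefMC coefC coefX mul1r sub0r.
under eq_bigr do rewrite lead1 mxE.
rewrite (bigD1 (enum_val x)) //= eqxx mulrNN mul1r (inj_eq enum_val_inj) big1 ?addr0 //.
by move=> p /negPf->; rewrite oppr0 mul0r.
Qed.

(** * The code generated by the chains of rows of [H] and its Euclidean dual *)

Variables (H : 'M[F]_(m, n)) (R : 'M[F]_(n, m)).
Hypothesis HR : H *m R = 1%:M.

Definition chain_gen : 'M[{poly F}]_(k, n) := chain_mx *m map_mx polyC H.

Local Notation W := (row_base (kermx H^T)).

(** By [H R = 1] the rows of [R^T] are dual to the rows of [H]; those of [W] span the vectors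
    orthogonal to [H]. *)
Definition chain_dual_basis : 'M[F]_(m + \rank (kermx H^T), n) := col_mx R^T W.

Definition chain_dual_gen : 'M[{poly F}]_(#|chain_step| + \rank (kermx H^T), n) :=
  block_mx step_mx 0 0 1%:M *m map_mx polyC chain_dual_basis.

Lemma right_inverse_row_free : row_free H.
Proof. by apply/row_freeP; exists R. Qed.

Lemma row_base_ker_mul : W *m H^T = 0.
Proof. by apply/sub_kermxP; rewrite eq_row_base. Qed.

(** Multiplying a relation [a R^T + b W = 0] by [H^T] kills [W] and leaves [a = 0]; then [b = 0], as
    [W] is a basis. *)
Lemma row_free_chain_dual_basis : row_free chain_dual_basis.
Proof.
rewrite -kermx_eq0 -submx0; apply/row_subP => i.
have := sub_kermxP (row_sub i (kermx chain_dual_basis)).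
rewrite -[row i _]hsubmxK mul_row_col; set a := lsubmx _; set b := rsubmx _ => ab0.
have a0 : a = 0.
  move/(congr1 (mulmx^~ H^T)): ab0.
  by rewrite mulmxDl -2!mulmxA row_base_ker_mul -trmx_mul HR trmx1 mulmx0 mulmx1 addr0 mul0mx.
move: ab0; rewrite a0 mul0mx add0r => /eqP.
by rewrite mulmx_free_eq0 ?row_base_free // => /eqP->; rewrite row_mx0 sub0mx.
Qed.

Lemma basic_chain_gen : basic chain_gen.
Proof. exact: basic_mul_const basic_chain_mx right_inverse_row_free. Qed.

Lemma row_reduced_chain_gen : row_reduced (fun j : 'I_k => e j) chain_gen.
Proof. exact: row_reduced_mul_const row_reduced_chain_mx right_inverse_row_free. Qed.

Lemma basic_chain_dual_gen : basic chain_dual_gen.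
Proof.
apply: basic_mul_const row_free_chain_dual_basis.
by apply: basic_block basic_step_mx _; exists 1%:M; rewrite mulmx1.
Qed.

Lemma row_reduced_chain_dual_gen :
  row_reduced (split_degree (fun=> 1%N) (fun=> 0%N)) chain_dual_gen.
Proof.
apply: row_reduced_mul_const row_free_chain_dual_basis.
exact: row_reduced_block row_reduced_step_mx (row_reduced1 F _).
Qed.

(** Orthogonality splits into step conditions on [A R] and orthogonality to the constant vectors
    [W]. *)
Lemma rev_prod_chain_dual_gen r (A : 'M[{poly F}]_(r, n)) :
  rev_prod A chain_dual_gen =
  row_mx (rev_prod (A *m map_mx polyC R) step_mx)
         (map_mx (fun p : {poly F} => tofrac p) (A *m map_mx polyC W^T)).
Proof.
rewrite rev_prodMr rev_prod_const tr_col_mx trmxK map_row_mx mul_mx_row map_row_mx.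
rewrite map_block_mx tr_block_mx /= !map_mx0 map_mx1 !trmx0 trmx1 mul_row_block.
by rewrite !mulmx0 mulmx1 addr0 add0r.
Qed.

Lemma rev_prod_step_mx r (A : 'M[{poly F}]_(r, m)) i x :
  rev_prod A step_mx i x =
  tofrac (A i (chain_pred (enum_val x))) - tofrac (A i (enum_val x)) * (tofrac 'X)^-1.
Proof.
rewrite !mxE.
under eq_bigr do rewrite !mxE rmorphB rmorphM !rmorph_nat /= at_invXX mulrBr mulrA.
rewrite big_split /= sumrN; congr (_ - _).
  by rewrite (bigD1 (chain_pred (enum_val x))) //= eqxx mulr1 big1 ?addr0 // =>
    p /negPf->; rewrite mulr0.
by rewrite (bigD1 (enum_val x)) //= eqxx mulr1 big1 ?addr0 // => p /negPf->; rewrite mulr0 mul0r.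
Qed.

Lemma tofracX_neq0 : tofrac ('X : {poly F}) != 0.
Proof. by rewrite tofrac_eq0 polyX_eq0. Qed.

(** In the coordinates given by [H], the entry at [p] is [X] times the one at its predecessor, and
    the factor [1/X] from the substitution cancels it. *)
Lemma rev_prod_chain_gen : rev_prod chain_gen chain_dual_gen = 0.
Proof.
rewrite rev_prod_chain_dual_gen /chain_gen -!mulmxA -!map_mxM HR map_mx1 mulmx1.
have -> : H *m W^T = 0 by apply: trmx_inj; rewrite trmx_mul trmxK row_base_ker_mul trmx0.
rewrite map_mx0 mulmx0 map_mx0; apply/eqP; rewrite row_mx_eq0 eqxx andbT; apply/eqP.
apply/matrixP => j x; rewrite rev_prod_step_mx !mxE ch_chain_pred lv_chain_pred.
case: eqP => _; last by rewrite rmorph0 mul0r subrr.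
rewrite -{2}(prednK (enum_val_lv_gt0 x)) exprSr rmorphM mulfK ?subrr //.
exact: tofracX_neq0.
Qed.

(* The constant rows of the dual generator force [v = x H]; its rows
   [f_(pred p) - X f_p] then force [x_p = X x_(pred p)], so that [x] is
   determined by its values at the bottom of the chains. *)
Lemma euclidean_dual_chain_dual_gen v :
  euclidean_dual (row_module chain_dual_gen) v -> row_module chain_gen v.
Proof.
move/euclidean_dual_row_module; rewrite rev_prod_chain_dual_gen => /eqP.
rewrite row_mx_eq0 => /andP[/eqP step0 /eqP ker0].
set x := v *m map_mx polyC R in step0.
have vW0 : v *m map_mx polyC W^T = 0.
  apply/matrixP => i j; move/matrixP/(_ i j): ker0; rewrite [LHS]mxE [RHS]mxE => /eqP.
  by rewrite tofrac_eq0 => /eqP->; rewrite mxE.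
have Dv : v = x *m map_mx polyC H.
  apply/eqP; rewrite -subr_eq0 /x -mulmxA -map_mxM -{1}[v]mulmx1 -(map_mx1 (@polyC F)).
  rewrite -mulmxBr -map_mxB; apply/eqP.
  (* [H (1 - R H) = 0], so the columns of [1 - R H] are combinations of those of [W^T], which [v]
     annihilates. *)
  have : ((1%:M - R *m H)^T <= W)%MS.
    rewrite eq_row_base; apply/sub_kermxP.
    by rewrite -trmx_mul mulmxBr mulmx1 mulmxA HR mul1mx subrr trmx0.
  case/submxP=> Z /(congr1 trmx); rewrite trmxK trmx_mul => ->.
  by rewrite map_mxM mulmxA vW0 mul0mx.
clearbody x.
have stepx p : (0 < lv p)%N -> x 0 p = x 0 (chain_pred p) * 'X.
  move=> p0; have Xp : p \in chain_step by [].
  have /matrixP/(_ 0 (enum_rank_in Xp p)) := step0.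
  rewrite rev_prod_step_mx enum_rankK_in // [RHS]mxE => /eqP; rewrite subr_eq0 => /eqP eqx.
  apply/eqP; rewrite -tofrac_eq tofracM eqx -mulrA mulVf ?mulr1 //.
  exact: tofracX_neq0.
have bottom (j : 'I_k) : exists p, (ch p == j) && (lv p == 0%N).
  by have [p [chp lvp]] := ch_lv_onto (ltn_ord j) (leq0n _); exists p; rewrite chp lvp !eqxx.
exists (\row_j x 0 (xchoose (bottom j))); rewrite mulmxA {1}Dv; congr (_ *m _).
apply/rowP => p; rewrite !mxE (bigD1 (Ordinal (ch_lt p))) //= !mxE eqxx big1 ?addr0; last first.
  move=> j ne_j; rewrite !mxE; case: eqP => [chp|]; last by rewrite mulr0.
  by case/eqP: ne_j; apply: val_inj.
have /andP[/eqP /= ] := xchooseP (bottom (Ordinal (ch_lt p))).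
move: (xchoose _) => b; move Di: (lv p) => i.
(* Each step down the chain gives one factor [X]; at level 0 only the bottom [b] is left. *)
elim: i p Di => [|i IHi] p lvp chb /eqP lvb.
  by rewrite expr0 mulr1; congr (x 0 _); apply: ch_lv_inj; rewrite ?chb ?lvb.
rewrite stepx ?lvp // exprSr mulrA (IHi (chain_pred p)) ?ch_chain_pred ?lvb //.
by rewrite lv_chain_pred lvp.
Qed.

End Chains.

(** * Distances *)

Section MinimumWeights.

Lemma nat_min_le (S : set nat) x : S x -> (nat_min S <= (Posz x)%:E)%E.
Proof.
rewrite /nat_min => Sx; case: pselect => [ex|]; last by case; exists x; apply/asboolP.
by rewrite lee_fin; case: ex_minnP => y _ ymin; rewrite lez_nat ymin //; apply/asboolP.
Qed.

Lemma le_nat_min (S T : set nat) :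
  (forall x, T x -> exists2 y, S y & (y <= x)%N) -> (nat_min S <= nat_min T)%E.
Proof.
move=> leST; rewrite [leRHS]/nat_min; case: pselect => [ex|_]; last exact: leey.
case: ex_minnP => x /asboolP Tx _; have [y Sy le_yx] := leST x Tx.
by apply: le_trans (nat_min_le Sy) _; rewrite lee_fin lez_nat.
Qed.

Lemma min_weight_subset (F : fieldType) n (T U : set 'rV[{poly F}]_n) :
  (T `<=` U)%classic -> (min_weight U <= min_weight T)%E.
Proof.
move=> subTU; apply: le_nat_min => _ [v Tv <-]; exists (weight v) => //.
by exists v => //; apply: subTU.
Qed.

(* Every coefficient vector of a codeword is in the row space of [H]. *)
Lemma min_distance_le_free_distance (F : fieldType) m n k
    (H : 'M[F]_(m, n)) (G : 'M[{poly F}]_(k, m)) :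
  (min_distance (block_dual (parity_check_code H)) <=
   free_distance (row_module (G *m map_mx polyC H)))%E.
Proof.
apply: le_nat_min => _ [v [[u Dv] /eqP v0] <-].
(* The leading coefficient of a nonzero entry makes the coefficient vector [y] at degree [t]
   nonzero. *)
have [j [t nz_vjt]] : exists j t, (v 0 j)`_t != 0.
  have /rV0Pn[j vj0] := v0; exists j, (size (v 0 j)).-1.
  by rewrite -[_`_ _]/(lead_coef _) lead_coef_eq0.
pose y := map_mx (coefp t) v.
exists (hamming_dist y 0).
  exists (y, 0) => //=; split; last split.
  - move=> x Cx; have -> : y = map_mx (coefp t) (u *m G) *m H.
      apply/rowP => l; rewrite /y Dv mulmxA !mxE /= coef_sum.
      by apply: eq_bigr => p _; rewrite !mxE coefMC.
    by rewrite -mulmxA Cx mulmx0.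
  - by move=> x _; rewrite mul0mx.
  - by apply: contra_neq nz_vjt => /rowP/(_ j); rewrite !mxE.
(* Each nonzero coordinate of [y] is one of the nonzero coefficients counted in that component of
   [v]. *)
rewrite /hamming_dist -sum1_card big_mkcond; apply: leq_sum => l _.
rewrite inE !mxE /=; case: ifP => // nz_vlt; rewrite -has_count; apply/hasP.
exists (v 0 l)`_t => //; apply: mem_nth; rewrite ltnNge.
by apply: contraTN nz_vlt => ?; rewrite negbK nth_default.
Qed.

End MinimumWeights.

(** * Counting with decreasing sequences, and Abel summation *)

Section DecreasingSums.
Variables (mu : nat) (r : nat -> nat).
Hypothesis r_dec : forall i j, (i <= j)%N -> (j <= mu)%N -> (r j <= r i)%N.

(** The [t] with [a < r t] form an initial segment of [1..mu], so their number reaches [i] exactly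
    when [i] is one of them. *)
Lemma leq_sum_ltn_dec a i : (0 < i)%N -> (i <= mu)%N ->
  (i <= \sum_(1 <= t < mu.+1) (a < r t))%N = (a < r i)%N.
Proof.
move=> i0 le_i; rewrite (big_cat_nat i0 (leqW le_i)) /=.
have sum1 b c : (\sum_(b <= t < c) 1 = c - b)%N by rewrite sum_nat_const_nat muln1.
have [lt_a|le_a] := ltnP a (r i).
  rewrite big_nat_recl // lt_a.
  rewrite (eq_big_nat _ _ (F2 := fun=> 1%N)) ?sum1; first by lia.
  move=> t /andP[_ lt_t]; rewrite (leq_trans lt_a) // r_dec //; lia.
have -> : (\sum_(i <= t < mu.+1) (a < r t) = 0)%N.
  rewrite big_nat; apply: big1 => t /andP[le_it lt_t].
  by rewrite ltnNge (leq_trans _ le_a) // r_dec.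
apply/negbTE; rewrite addn0 -ltnNge.
apply: leq_ltn_trans (_ : \sum_(1 <= t < i) 1 < i)%N; last by rewrite sum1; lia.
by apply: leq_sum => t _; case: (_ < _)%N.
Qed.

Lemma sum_ltn_dec_le a : (\sum_(1 <= t < mu.+1) (a < r t) <= mu)%N.
Proof.
apply: (@leq_trans (\sum_(1 <= t < mu.+1) 1)%N).
  by apply: leq_sum => t _; case: (_ < _)%N.
by rewrite sum_nat_const_nat muln1 subn1.
Qed.

Lemma sum_ltn_ord b c : (c <= b)%N -> (\sum_(j < b) (j < c) = c)%N.
Proof.
by move=> le_cb; rewrite -big_mkcond (big_ord_narrow le_cb) sum1_card card_ord.
Qed.

(** Double counting: a partition and its conjugate have the same size. *)
Lemma sum_ltn_dec : (\sum_(j < r 0) \sum_(1 <= t < mu.+1) (j < r t) = \sum_(1 <= t < mu.+1) r t)%N.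
Proof.
rewrite exchange_big /=; apply: eq_big_nat => t /andP[_ lt_t].
by rewrite sum_ltn_ord // r_dec.
Qed.

(** After the substitution of [mu - i] for [i] this is Abel summation; monotonicity makes the
    truncated differences exact. *)
Lemma abel_sum_dec : (0 < mu)%N ->
  (mu * r mu + \sum_(1 <= i < mu) (mu - i) * (r (mu - i) - r (mu - i + 1)) =
   \sum_(1 <= i < mu.+1) r i)%N.
Proof.
move=> mu0.
have -> : (\sum_(1 <= i < mu) (mu - i) * (r (mu - i) - r (mu - i + 1)) =
           \sum_(1 <= i < mu) i * (r i - r i.+1))%N.
  rewrite [RHS]big_nat_rev /=; apply: eq_big_nat => i /andP[i0 lt_i].
  by rewrite add1n subSS addn1.
elim: mu mu0 r_dec => // -[_ _ _|s IHs _ dec].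
  by rewrite big_geq // big_nat1 addn0 mul1n.
rewrite [RHS]big_nat_recr //= -(IHs _ _) //; last by move=> i j *; apply: dec => //; lia.
rewrite [in LHS]big_nat_recr //=; have := dec s.+1 s.+2 (leqnSn _) (leqnn _).
by move: (\sum_(_ <= _ < _) _)%N (r s.+1) (r s.+2) => S a b; nia.
Qed.

End DecreasingSums.

(** * The chains of the construction *)

Section ConstructionChains.
Variables (F : fieldType) (m n mu : nat) (H : 'M[F]_(m, n)).
Variables B B' : 'I_mu.+1 -> {set 'I_m}.
Hypothesis freeH : row_free H.
Hypothesis partB : row_partition B B'.

(** Rows chosen from independent rows are independent; ranks of blocks thus become cardinalities. *)
Lemma rank_row_block (X : {set 'I_m}) : \rank (row_block H X) = #|X|.
Proof.
have [R HR] := row_freeP freeH; apply/eqP; rewrite -/(row_free _).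
apply/row_freeP; exists (colsub (fun i : 'I_#|X| => enum_val i) R).
rewrite -mxsub_mul HR; apply/matrixP => i j.
by rewrite !mxE (inj_eq enum_val_inj).
Qed.

Let k1 := \rank (row_block H (B ord0)).
Let k2 := \rank (row_block H (B' ord0)).

Definition level (p : 'I_m) : 'I_mu.+1 :=
  odflt ord0 [pick i | (p \in B i) || (p \in B' i)].

(** A row is numbered by its position in its block, so equal positions in successive blocks form a
    chain; the [B'] chains come after the first [k1] numbers. *)
Definition chain (p : 'I_m) : nat :=
  if p \in B (level p) then index p (enum (B (level p)))
  else (\rank (row_block H (B ord0)) + index p (enum (B' (level p))))%N.

(** The top level of a chain, one less than its number of elements: a [B'] chain runs on while the
    blocks have a row at its position. *)
Definition chain_length (j : nat) : nat :=
  if (j < k1)%N then mu else (\sum_(1 <= t < mu.+1) (j - k1 < #|B' (inord t)|))%N.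

Hypothesis rankB : forall i, \rank (row_block H (B i)) = k1.
Hypothesis rankB' : forall i j : 'I_mu.+1, (i <= j)%N ->
  (\rank (row_block H (B' j)) <= \rank (row_block H (B' i)))%N.

Lemma cardB i : #|B i| = k1.
Proof. by rewrite -rank_row_block rankB. Qed.

Lemma cardB'0 : #|B' ord0| = k2.
Proof. by rewrite -rank_row_block. Qed.

Lemma cardB'_le (i j : 'I_mu.+1) : (i <= j)%N -> (#|B' j| <= #|B' i|)%N.
Proof. by move/rankB'; rewrite !rank_row_block. Qed.

Lemma cardB'_dec i j : (i <= j)%N -> (j <= mu)%N -> (#|B' (inord j)| <= #|B' (inord i)|)%N.
Proof.
move=> le_ij le_j; apply: cardB'_le.
by rewrite !inordK // ltnS // (leq_trans le_ij).
Qed.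

Lemma disjoint_mem (X Y : {set 'I_m}) p : (X :&: Y)%SET = finset.set0 -> p \in X -> p \in Y = false.
Proof. by move=> XY0 Xp; have /setP/(_ p) := XY0; rewrite !inE Xp. Qed.

Lemma notin_B' i j p : p \in B i -> p \in B' j = false.
Proof. by case: partB => _ _ dBB' _; apply: disjoint_mem. Qed.

Lemma levelP p : (p \in B (level p)) || (p \in B' (level p)).
Proof.
rewrite /level; case: pickP => //= noi; case: partB => _ _ _ /setP/(_ p).
by rewrite !inE => /orP[] /bigcupP[i _ pi]; have := noi i; rewrite pi ?orbT.
Qed.

Lemma level_B i p : p \in B i -> level p = i.
Proof.
move=> Bip; case: partB => dB _ _ _; apply/eqP; apply: contraT => ne.
have := levelP p; rewrite (notin_B' _ Bip) orbF.
by rewrite (disjoint_mem (dB _ _ (_ : i != level p)) Bip) // eq_sym.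
Qed.

Lemma level_B' i p : p \in B' i -> level p = i.
Proof.
move=> Bip; case: partB => _ dB' _ _; apply/eqP; apply: contraT => ne.
have /orP[Bp|] := levelP p; first by rewrite (notin_B' i Bp) in Bip.
by rewrite (disjoint_mem (dB' _ _ (_ : i != level p)) Bip) // eq_sym.
Qed.

Lemma chain_B i p : p \in B i -> chain p = index p (enum (B i)).
Proof. by move=> Bp; rewrite /chain (level_B Bp) Bp. Qed.

Lemma chain_B' i p : p \in B' i -> chain p = (k1 + index p (enum (B' i)))%N.
Proof.
move=> Bp; rewrite /chain (level_B' Bp); case: ifP => // Bip.
by rewrite (notin_B' _ Bip) in Bp.
Qed.

Lemma index_enum_lt (X : {set 'I_m}) p : p \in X -> (index p (enum X) < #|X|)%N.
Proof. by rewrite cardE index_mem mem_enum. Qed.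

Lemma index_enum_inj (X : {set 'I_m}) p q :
  p \in X -> q \in X -> index p (enum X) = index q (enum X) -> p = q.
Proof. by move=> Xp Xq; apply: (index_inj p); rewrite mem_enum. Qed.

Lemma index_enum_onto (X : {set 'I_m}) j :
  (j < #|X|)%N -> exists2 p, p \in X & index p (enum X) = j.
Proof.
move=> lt_j; exists (enum_val (Ordinal lt_j)); first exact: enum_valP.
rewrite (enum_val_nth (enum_val (Ordinal lt_j))) index_uniq ?enum_uniq //.
by rewrite -cardE.
Qed.

Lemma chain_lt p : (chain p < k1 + k2)%N.
Proof.
case/orP: (levelP p) => Bp.
  by rewrite (chain_B Bp) ltn_addr // -(cardB (level p)) index_enum_lt.
rewrite (chain_B' Bp) ltn_add2l (leq_trans (index_enum_lt Bp)) //.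
by rewrite -cardB'0 cardB'_le.
Qed.

Lemma level_le p : (level p <= chain_length (chain p))%N.
Proof.
rewrite /chain_length; case/orP: (levelP p) => Bp.
  by rewrite (chain_B Bp) -(cardB (level p)) index_enum_lt // -ltnS.
rewrite (chain_B' Bp) ltnNge leq_addr addKn /=.
have [->|l0] := posnP (level p); first exact: leq0n.
rewrite (leq_sum_ltn_dec cardB'_dec) //; last by rewrite -ltnS.
by rewrite inord_val index_enum_lt.
Qed.

Lemma chain_level_inj p q : chain p = chain q -> level p = level q :> nat -> p = q.
Proof.
move=> + /val_inj lpq; case/orP: (levelP p) => Bp; case/orP: (levelP q) => Bq.
- by rewrite (chain_B Bp) (chain_B Bq); rewrite lpq in Bp *; apply: index_enum_inj.
- rewrite (chain_B Bp) (chain_B' Bq) => eq_i.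
  by have := index_enum_lt Bp; rewrite eq_i cardB ltnNge leq_addr.
- rewrite (chain_B' Bp) (chain_B Bq) => eq_i.
  by have := index_enum_lt Bq; rewrite -eq_i cardB ltnNge leq_addr.
- rewrite (chain_B' Bp) (chain_B' Bq) => /addnI.
  by rewrite lpq in Bp *; apply: index_enum_inj.
Qed.

Lemma chain_level_onto j i :
  (j < k1 + k2)%N -> (i <= chain_length j)%N -> exists p, chain p = j /\ level p = i :> nat.
Proof.
rewrite /chain_length; have [lt_j _ le_i|le_j lt_j le_i] := ltnP j k1.
  have [|p Bp <-] := @index_enum_onto (B (inord i)) j; first by rewrite cardB.
  by exists p; rewrite (chain_B Bp) (level_B Bp) inordK.
have le_i_mu : (i <= mu)%N by apply: leq_trans le_i (sum_ltn_dec_le _ _ _).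
have [|p Bp idx] := @index_enum_onto (B' (inord i)) (j - k1).
  (* Level 0 is not counted in [chain_length]; there [j < k1 + k2] places the row in [B' ord0]. *)
  have [i0|i0] := posnP i.
    by rewrite i0 -[inord 0]/(inord (ord0 : 'I_mu.+1)) inord_val cardB'0; lia.
  by rewrite -(leq_sum_ltn_dec cardB'_dec).
by exists p; rewrite (chain_B' Bp) (level_B' Bp) inordK // idx subnKC.
Qed.

(** The sum has at most one term, and is empty precisely on the zero rows added by padding. *)
Lemma pad_rows_row_block k (X : {set 'I_m}) (j : 'I_k) l :
  pad_rows k (row_block H X) j l = \sum_(p | (p \in X) && (index p (enum X) == j)) H p l.
Proof.
rewrite mxE; case: insubP => [i _ vi | ].
  rewrite /= !mxE (big_pred1 (enum_val i)) // => p.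
  apply/andP/eqP => [[Xp /eqP idx] | ->].
    apply: (index_enum_inj Xp (enum_valP i)); rewrite idx -vi.
    by rewrite (enum_val_nth (enum_val i)) index_uniq ?enum_uniq -?cardE.
  split; first exact: enum_valP.
  by rewrite -vi (enum_val_nth (enum_val i)) index_uniq ?enum_uniq -?cardE.
rewrite -leqNgt => le_j; rewrite big1 //= => p /andP[Xp /eqP idx].
by have := index_enum_lt Xp; rewrite idx ltnNge le_j.
Qed.

(** Row [i] of the coefficient of [X^t] is the element of chain [i] at level [t], or zero if the
    chain ends below [t]. *)
Lemma col_mx_pad_rows (t : 'I_mu.+1) (i : 'I_(k1 + k2)) l :
  col_mx (pad_rows k1 (row_block H (B t))) (pad_rows k2 (row_block H (B' t))) i l =
  \sum_(p | (chain p == i) && (level p == t)) H p l.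
Proof.
rewrite -[i]splitK; case: (split i) => j /=.
  rewrite col_mxEu pad_rows_row_block; apply: eq_bigl => p /=.
  apply/andP/andP => [[Bp /eqP idx] | [/eqP chp /eqP lvp]].
    by rewrite (chain_B Bp) (level_B Bp) idx !eqxx.
  case/orP: (levelP p) => Bp; last by have := ltn_ord j; rewrite -chp (chain_B' Bp); lia.
  by move: chp; rewrite (chain_B Bp) -lvp Bp => ->.
rewrite col_mxEd pad_rows_row_block; apply: eq_bigl => p /=.
apply/andP/andP => [[Bp /eqP idx] | [/eqP chp /eqP lvp]].
  by rewrite (chain_B' Bp) (level_B' Bp) idx !eqxx.
case/orP: (levelP p) => Bp; last by move: chp; rewrite (chain_B' Bp) -lvp Bp => /addnI->.
by have := index_enum_lt Bp; rewrite cardB -(chain_B Bp) chp; lia.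
Qed.

Lemma gen1_chain_gen : gen1 H B B' = chain_gen (k1 + k2) chain level H.
Proof.
apply/matrixP => i l; rewrite /gen1 summxE [RHS]mxE.
under eq_bigr do rewrite mxE [X in _ * X]mxE col_mx_pad_rows rmorph_sum mulr_sumr.
under [RHS]eq_bigr do rewrite !mxE (fun_if (fun x => x * _)) mul0r.
rewrite -big_mkcond /= [RHS](partition_big level xpredT) //=.
by apply: eq_bigr => t _; apply: eq_bigr => p /andP[_ /eqP->].
Qed.

(** Through this [gen2] inherits basicness, row-reducedness and orthogonality from [gen1]. *)
Lemma gen2_dsub : gen2 H B' = dsubmx (gen1 H B B').
Proof.
rewrite /gen1 linear_sum; apply: eq_bigr => t _.
by rewrite linearZ /= map_col_mx col_mxKd.
Qed.

Lemma sum_chain_length2 :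
  (\sum_(j < k2) chain_length (k1 + j) = \sum_(1 <= t < mu.+1) #|B' (inord t)|)%N.
Proof.
rewrite -(sum_ltn_dec cardB'_dec) -[inord 0]/(inord (ord0 : 'I_mu.+1)) inord_val cardB'0.
apply: eq_bigr => j _; rewrite /chain_length ltnNge leq_addr /=.
by rewrite addKn.
Qed.

Lemma sum_chain_length :
  (\sum_(j < k1 + k2) chain_length j = mu * k1 + \sum_(1 <= t < mu.+1) #|B' (inord t)|)%N.
Proof.
rewrite big_split_ord -sum_chain_length2; congr (_ + _)%N.
rewrite (eq_bigr (fun=> mu)) ?sum_nat_const ?card_ord 1?mulnC // => j _.
by rewrite /chain_length /= ltn_ord.
Qed.

End ConstructionChains.

(** * Assembly of the quantum code and its parameters *)

Theorem theorem3p1 (F : finFieldType) (m n mu : nat) (H : 'M[F]_(m, n))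
    (B B' : 'I_mu.+1 -> {set 'I_m}) :
  let rk i := \rank (row_block H (B i)) in
  let rk' i := \rank (row_block H (B' i)) in
  let gamma2 := (mu * rk' ord_max + \sum_(1 <= i < mu)
        (mu - i) * (rk' (inord (mu - i)) - rk' (inord (mu - i + 1))))%N in
  let gamma1 := (mu * (rk ord_max + rk' ord_max) + \sum_(1 <= i < mu)
        (mu - i) * (rk' (inord (mu - i)) - rk' (inord (mu - i + 1))))%N in
  let V1 := row_module (gen1 H B B') in
  let V2 := row_module (gen2 H B') in
  let d1 := free_distance V1 in
  let d2perp := free_distance (euclidean_dual V2) in
  let dperp := min_distance (block_dual (parity_check_code H)) in
  (0 < n)%N -> (0 < mu)%N -> (m < n)%N ->
  row_free H ->
  row_partition B B' ->
  (forall i j, rk i = rk j) ->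
  (forall i j : 'I_mu.+1, (i <= j)%N -> (rk' j <= rk' i)%N) ->
  (exists (mu_star : nat) (dz dx : \bar int),
     is_aqcc F n (rk ord0) mu_star (gamma1 + gamma2) dz dx /\
     (if (d1 <= d2perp)%E then (d1 <= dx)%E /\ (d2perp <= dz)%E
      else (d2perp <= dx)%E /\ (d1 <= dz)%E)) /\
  (dperp <= d1)%E.
Proof.
move=> rk rk' gamma2 gamma1 V1 V2 d1 d2perp dperp _ mu0 lt_mn freeH partB rankB rankB'.
have [R HR] := row_freeP freeH.
have rankB0 i : \rank (row_block H (B i)) = \rank (row_block H (B ord0)) by apply: rankB.
have ch_lt := chain_lt freeH partB rankB0 rankB'.
have lv_le := level_le freeH partB rankB0 rankB'.
have lv_inj := chain_level_inj freeH partB rankB0.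
have lv_onto := chain_level_onto freeH partB rankB0 rankB'.
have G1E := gen1_chain_gen freeH partB rankB0.
set k1 := \rank (row_block H (B ord0)) in rankB0 ch_lt lv_le lv_inj lv_onto G1E.
set k2 := \rank (row_block H (B' ord0)) in ch_lt lv_le lv_inj lv_onto G1E.
pose Bd := chain_dual_gen (chain H B B') (level B B') H R.
split; last by rewrite /d1 /V1 G1E; apply: min_distance_le_free_distance.
have basA : basic (gen2 H B').
  rewrite (gen2_dsub H B) G1E; apply: basic_dsub.
  exact: (basic_chain_gen lv_inj lv_onto HR).
have redA : row_reduced (fun j : 'I_k2 => chain_length H B B' (k1 + j)) (gen2 H B').
  rewrite (gen2_dsub H B) G1E.
  exact: (row_reduced_dsub (row_reduced_chain_gen lv_le lv_inj lv_onto HR)).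
have basB : basic Bd by apply: (basic_chain_dual_gen ch_lt lv_le lv_inj lv_onto HR).
have redB := row_reduced_chain_dual_gen ch_lt lv_le lv_onto HR; rewrite -/Bd in redB.
have cardX := card_chain_steps ch_lt lv_le lv_inj lv_onto.
have summ := row_count_chains ch_lt lv_le lv_inj lv_onto.
have sum_len := sum_chain_length B freeH rankB'; rewrite -/k1 -/k2 in sum_len.
have sum_len2 := sum_chain_length2 B freeH rankB'; rewrite -/k1 -/k2 in sum_len2.
set Sg := (\sum_(1 <= t < mu.+1) _)%N in sum_len sum_len2.
(* By Abel summation the common part of [gamma1] and [gamma2] is the total size of the blocks [B' t]
   with [t >= 1]. *)
have abelE : (mu * rk' ord_max + \sum_(1 <= i < mu)
    (mu - i) * (rk' (inord (mu - i)) - rk' (inord (mu - i + 1))) = Sg)%N.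
  rewrite /Sg -(abel_sum_dec (cardB'_dec freeH rankB')) //.
  rewrite -[ord_max]inord_val /= {1}/rk' rank_row_block //; congr (_ + _)%N.
  by apply: eq_bigr => i _; rewrite /rk' !rank_row_block.
have orthAB : rev_prod (gen2 H B') Bd = 0.
  rewrite (gen2_dsub H B) G1E -[chain_gen _ _ _ _]mul1mx -mul_dsub_mx rev_prodMl.
  by rewrite (rev_prod_chain_gen ch_lt lv_le lv_onto HR) mulmx0.
set S := block_mx (gen2 H B') 0 0 Bd.
have redS := row_reduced_block redA redB; rewrite -/S in redS.
pose wA := min_weight (euclidean_dual (row_module Bd) `\` row_module (gen2 H B'))%classic.
pose wB := min_weight (euclidean_dual (row_module (gen2 H B')) `\` row_module Bd)%classic.
have row_module0 k (G : 'M[{poly F}]_(k, n)) : row_module G 0 by exists 0; rewrite mul0mx.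
(* The dual of the row module of [Bd] lies in [V1], and a vector outside a submodule is nonzero. *)
have le_d1 : (d1 <= wA)%E.
  apply: min_weight_subset => v [dv nv]; split; last by move=> v0; apply: nv; rewrite v0.
  by rewrite /V1 G1E; apply: (euclidean_dual_chain_dual_gen ch_lt lv_le lv_inj lv_onto HR).
have le_d2 : (d2perp <= wB)%E.
  by apply: min_weight_subset => v [dv nv]; split=> // v0; apply: nv; rewrite v0.
exists (memory S), (Order.max wA wB), (Order.min wA wB); split.
  exists k2, (#|chain_step (level B B')| + \rank (kermx H^T))%N, (gen2 H B'), Bd; split=> //.
  - by split=> //; apply: row_reduced_reduced redS; apply: basic_block.
  (* With [s] the sum of the chain lengths, [k2 + (s + (n - m)) + k1 = n] because
     [m = k1 + k2 + s]. *)
  - rewrite mxrank_ker mxrank_tr (eqP freeH) cardX /rk -/k1.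
    move: summ; move: (\sum_(j < _) _)%N => s; lia.
  (* [gen2] contributes [gamma2]; in [Bd] the step rows have degree 1 and the constant rows degree
     0, so it contributes the number of steps, [gamma1]. *)
  - rewrite (row_reduced_constraint_length redS) !sum_split_degree sum_len2.
    rewrite sum_nat_const card_ord muln1 sum_nat_const muln0 addn0 cardX sum_len.
    by rewrite /gamma1 /gamma2 abelE mulnDr -(addnA (mu * _)%N) abelE (rankB _ ord0) addnC.
(* The smaller of the two bounds lies below both [wA] and [wB], hence below their minimum; the
   larger one lies below the maximum. *)
case: ifPn => [le12|nle12]; rewrite le_min !le_max le_d1 le_d2 ?orbT /=.
  by rewrite (le_trans le12).
rewrite -ltNge in nle12.
by rewrite (le_trans (ltW nle12)).
Qed.
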